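(* Let $\{\alpha(n)\}_{n=0}^{\infty}$ be a sequence of real numbers with $\alpha(n)>0$ for all $n$. Suppose there is an integer $n_0\geq 1$ such that $\alpha(n)^2\geq \alpha(n-1)\,\alpha(n+1)$ for all $n\geq n_0$, and such that $$\alpha(n_0)^{1/n_0} > \frac{\alpha(n_0)}{\alpha(n_0-1)}.$$ Let $$A=\left\{ a\in\mathbb{Z} : 1\leq a\leq n_0-2,\ \alpha(a)^{1/a} > \frac{\alpha(n_0)}{\alpha(n_0-1)}\right\}.$$ Let $m,n\geq 1$ be integers satisfying $$\big(m\geq n_0-1 \text{ and } n\geq n_0-1\big)\ \text{ or }\ \big(m\in A \text{ and } n\geq n_0-1\big)\ \text{ or }\ \big(m\geq n_0-1 \text{ and } n\in A\big).$$ Then $\alpha(m)\,\alpha(n) > \alpha(m+n)$. *)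

(* Defs.v *)
From Stdlib Require Import Reals.
Open Scope R_scope.

(* [Rpower x y] is [exp (y * ln x)], the usual power for [0 < x]. *)
Definition nth_root (n : nat) (x : R) : R := Rpower x (1 / INR n).

(* As [1 <= a], an integer [a] is a natural number; [a <= n0 - 2] is written
   [a + 2 <= n0] because subtraction on [nat] is truncated. *)
Definition setA (alpha : nat -> R) (n0 : nat) (a : nat) : Prop :=
  (1 <= a)%nat /\ (a + 2 <= n0)%nat /\
  nth_root a (alpha a) > alpha n0 / alpha (n0 - 1)%nat.

(* Main.v *)
Require Import Defs.
From Stdlib Require Import Reals Lra Lia.
Open Scope R_scope.

(** Put [N = n0 - 1] and [q = alpha (N + 1) / alpha N]. Log-concavity makes the
    ratios [alpha (k + 1) / alpha k] nonincreasing for [k >= N], so they are at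
    most [q] there and [alpha (m + n) <= q ^ m * alpha n] for [n >= N]. This
    settles every [m] with [q ^ m < alpha m], that is [m] in [A] and [m = N]. From
    [m = N] one climbs to all [m >= N], because going from [m] to [m + 1]
    multiplies [alpha m] by a ratio at least as large as the one multiplying
    [alpha (m + n)]. *)

(** Raising to the power [a] is strictly increasing on positive reals and undoes the root. This
    turns both root conditions of the theorem into bounds on integer powers of [q]. *)
Lemma nth_root_gt_pow (a : nat) (x q : R) :
  (1 <= a)%nat -> 0 < x -> 0 < q -> nth_root a x > q -> q ^ a < x.
Proof.
  intros Ha Hx Hq H.
  assert (HI : 0 < INR a) by (apply lt_0_INR; lia).
  unfold nth_root in H.
  rewrite <- (Rpower_pow a q Hq).
  replace x with (Rpower (Rpower x (1 / INR a)) (INR a)).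
  - now apply Rlt_Rpower_l.
  - rewrite Rpower_mult.
    replace (1 / INR a * INR a) with 1 by (field; lra).
    now apply Rpower_1.
Qed.

Section LogConcaveTail.

Variables (alpha : nat -> R) (N : nat).
Hypothesis alpha_pos : forall k, 0 < alpha k.
Hypothesis log_concave : forall k, (N <= k)%nat ->
  alpha k * alpha (S (S k)) <= alpha (S k) ^ 2.

Lemma tail_ratio_le (j k : nat) : (N <= j <= k)%nat ->
  alpha (S k) / alpha k <= alpha (S j) / alpha j.
Proof.
  intros [HNj Hjk]; induction Hjk as [|k Hjk IH]; [lra|].
  refine (Rle_trans _ _ _ _ IH).
  pose proof (alpha_pos k); pose proof (alpha_pos (S k)).
  (* Clearing both denominators leaves exactly log-concavity at [k]. *)
  apply (Rmult_le_reg_r (alpha k * alpha (S k))); [nra|].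
  replace (_ / _ * _) with (alpha k * alpha (S (S k))) by (field; lra).
  replace (_ / _ * _) with (alpha (S k) ^ 2) by (field; lra).
  apply log_concave; lia.
Qed.

(** Ratio monotonicity with denominators cleared, the form used in the climb on [m]. *)
Lemma tail_cross_le (j k : nat) : (N <= j <= k)%nat ->
  alpha (S k) * alpha j <= alpha (S j) * alpha k.
Proof.
  intros H; pose proof (alpha_pos j); pose proof (alpha_pos k).
  pose proof (tail_ratio_le j k H) as Hr.
  apply (Rmult_le_compat_r (alpha j * alpha k)) in Hr; [|nra].
  replace (_ / _ * _) with (alpha (S k) * alpha j) in Hr by (field; lra).
  replace (_ / _ * _) with (alpha (S j) * alpha k) in Hr by (field; lra).
  exact Hr.
Qed.

Let q := alpha (S N) / alpha N.

Lemma tail_ratio_pos : 0 < q.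
Proof. now apply Rdiv_lt_0_compat. Qed.

(** Each of the [i] steps up from [k] multiplies by a ratio at an index at least [N], hence by at
    most [q]. *)
Lemma tail_geometric_le (i k : nat) : (N <= k)%nat ->
  alpha (i + k)%nat <= q ^ i * alpha k.
Proof.
  intros Hk; induction i as [|i IH]; simpl; [lra|].
  pose proof (alpha_pos (i + k)); pose proof tail_ratio_pos.
  pose proof (tail_ratio_le N (i + k) ltac:(lia)) as Hr; fold q in Hr.
  replace (alpha (S (i + k)))
    with (alpha (S (i + k)) / alpha (i + k)%nat * alpha (i + k)%nat)
    by (field; lra).
  rewrite Rmult_assoc.
  apply Rle_trans with (q * alpha (i + k)%nat);
    [apply Rmult_le_compat_r | apply Rmult_le_compat_l]; lra.
Qed.

Lemma tail_submult_of_pow_lt (m n : nat) : (N <= n)%nat ->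
  q ^ m < alpha m -> alpha (m + n)%nat < alpha m * alpha n.
Proof.
  intros Hn Hm.
  apply Rle_lt_trans with (1 := tail_geometric_le m n Hn).
  now apply Rmult_lt_compat_r.
Qed.

Lemma tail_submult (m n : nat) : (N <= m)%nat -> (N <= n)%nat ->
  q ^ N < alpha N -> alpha (m + n)%nat < alpha m * alpha n.
Proof.
  intros Hm Hn HN; induction Hm as [|m Hm IH].
  - now apply tail_submult_of_pow_lt.
  - pose proof (alpha_pos m); pose proof (alpha_pos (S m)).
    (* The factor [alpha m] lets the ratios at [m] and [m + n] be compared by cross-multiplication;
       the induction hypothesis then bounds [alpha (m + n)]. *)
    apply (Rmult_lt_reg_r (alpha m)); [lra|].
    apply Rle_lt_trans with (alpha (S m) * alpha (m + n)%nat).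
    + apply (tail_cross_le m (m + n)); lia.
    + replace (alpha (S m) * alpha n * alpha m)
        with (alpha (S m) * (alpha m * alpha n)) by ring.
      now apply Rmult_lt_compat_l.
Qed.

End LogConcaveTail.

Theorem theorem1p1 (alpha : nat -> R)
  (alpha_pos : forall n : nat, alpha n > 0)
  (n0 : nat) (n0_ge1 : (n0 >= 1)%nat)
  (log_concave : forall n : nat, (n >= n0)%nat ->
     alpha n ^ 2 >= alpha (n - 1)%nat * alpha (n + 1)%nat)
  (root_gt : nth_root n0 (alpha n0) > alpha n0 / alpha (n0 - 1)%nat)
  (m n : nat) (m_ge1 : (m >= 1)%nat) (n_ge1 : (n >= 1)%nat)
  (mn : ((m >= n0 - 1)%nat /\ (n >= n0 - 1)%nat) \/
        (setA alpha n0 m /\ (n >= n0 - 1)%nat) \/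
        ((m >= n0 - 1)%nat /\ setA alpha n0 n)) :
  alpha m * alpha n > alpha (m + n)%nat.
Proof.
  destruct n0 as [|N]; [lia|].
  unfold setA in mn.
  replace (S N - 1)%nat with N in * by lia.
  assert (pos : forall k, 0 < alpha k) by (intro k; apply alpha_pos).
  (* The hypothesis is centred at [S k], so [S k >= n0] becomes [k >= N]. *)
  assert (lc : forall k, (N <= k)%nat ->
            alpha k * alpha (S (S k)) <= alpha (S k) ^ 2).
  { intros k Hk; specialize (log_concave (S k) ltac:(lia)).
    replace (S k - 1)%nat with k in log_concave by lia.
    replace (S k + 1)%nat with (S (S k)) in log_concave by lia.
    now apply Rge_le. }
  pose proof (tail_ratio_pos alpha N pos) as q_pos.
  assert (HA : forall a k, (N <= k)%nat -> (1 <= a)%nat ->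
            nth_root a (alpha a) > alpha (S N) / alpha N ->
            alpha (a + k)%nat < alpha a * alpha k).
  { intros a k Hk Ha Hroot.
    apply (tail_submult_of_pow_lt alpha N pos lc a k Hk).
    now apply nth_root_gt_pow. }
  destruct mn as [[Hm Hn] | [[[Hm [_ Hroot]] Hn] | [Hm [Hn [_ Hroot]]]]].
  - apply (tail_submult alpha N pos lc m n Hm Hn).
    (* Dividing [q ^ (N + 1) < alpha (N + 1)] by [q]. *)
    apply nth_root_gt_pow in root_gt; [|lia|apply pos|exact q_pos].
    apply (Rmult_lt_reg_l (alpha (S N) / alpha N)); [exact q_pos|].
    replace (alpha (S N) / alpha N * alpha N) with (alpha (S N))
      by (field; apply Rgt_not_eq, alpha_pos).
    exact root_gt.
  - now apply HA.
  (* The claim is symmetric in [m] and [n], so [n] takes the role of the element of [setA]. *)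
  - rewrite Nat.add_comm, Rmult_comm; now apply HA.
Qed.
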